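(* Let $\mathbb{F}_q$ be a finite field with $q$ elements, let $a$ be a positive integer, let $X=\mathbb{P}(1,1,a)$ be the weighted projective plane over $\overline{\mathbb{F}}_q$, and let $Y_Q=\{[t_0:t_1:t_2^a] : t_0,t_1,t_2\in\mathbb{F}_q^*\}\subset X$. Let $\alpha\ge0$ be an integer, and put $$d_2=\frac{q-1}{\gcd(a,q-1)},\qquad k=\left\lfloor\frac{\alpha-(q-2)}{a}\right\rfloor,\qquad \mu_2=\min\left\{\left\lfloor\frac{\alpha}{a}\right\rfloor,\,d_2-1\right\}.$$ Then the length of the code $\mathcal{C}_{\alpha,Y_Q}$ is $N=|Y_Q|=(q-1)d_2$. Its dimension is $$K(\mathcal{C}_{\alpha,Y_Q})=\begin{cases}(\mu_2+1)(\alpha+1-\mu_2a/2), & \text{if } 0\le\alpha\le q-2,\\ (q-1)(k+1)+(\mu_2-k)\left[\alpha+1-(\mu_2+k+1)a/2\right], & \text{if } 0<\alpha-(q-2)<(d_2-1)a,\\ N, & \text{otherwise,}\end{cases}$$ and its minimum distance is $$\delta(\mathcal{C}_{\alpha,Y_Q})=\begin{cases}d_2(q-1-\alpha), & \text{if } 0\le\alpha\le q-2,\\ d_2-k, & \text{if } q-2\le\alpha<(q-2)+(d_2-1)a,\\ 1, & \text{otherwise.}\end{cases}$$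
   Context: The weighted projective plane $\mathbb{P}(1,1,a)$ is $(\overline{\mathbb{F}}_q^{\,3}\setminus\{0\})/G$ with $G=\{(\lambda,\lambda,\lambda^a):\lambda\in\overline{\mathbb{F}}_q^*\}$ acting by componentwise multiplication; $[p_0:p_1:p_2]$ is the orbit of $(p_0,p_1,p_2)$. The ring $S=\mathbb{F}_q[x_0,x_1,x_2]$ is graded by $\deg x_0=\deg x_1=1$, $\deg x_2=a$, and $S_\alpha$ is the $\mathbb{F}_q$-vector space spanned by the monomials of degree $\alpha$. For a set $Y=\{P_1,\dots,P_N\}$ of $N$ distinct $\mathbb{F}_q$-rational points of $X$, each represented by a fixed vector of $\mathbb{F}_q^{3}$, the code $\mathcal{C}_{\alpha,Y}\subset\mathbb{F}_q^N$ is the image of the evaluation map $S_\alpha\to\mathbb{F}_q^N$, $F\mapsto(F(P_1),\dots,F(P_N))$. Its length is $N=|Y|$, its dimension $K(\mathcal{C}_{\alpha,Y})$ is its dimension over $\mathbb{F}_q$, and its minimum distance $\delta(\mathcal{C}_{\alpha,Y})$ is the minimum number of nonzero entries of a vector in $\mathcal{C}_{\alpha,Y}\setminus\{0\}$. These parameters do not depend on the choice of representatives. *)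

(* Defs.v *)
From HB Require Import structures.
From mathcomp Require Import all_boot all_order all_algebra.
From mathcomp Require Import all_classical.
From mathcomp Require Import mpoly.

Set Implicit Arguments.
Unset Strict Implicit.
Unset Printing Implicit Defensive.

Import GRing.Theory.

Local Open Scope classical_set_scope.
Local Open Scope ring_scope.

Definition weight (a : nat) (i : 'I_3) : nat := tnth [tuple 1%N; 1%N; a] i.

Definition vec3 (K : Type) (x y z : K) : 'rV[K]_3 :=
  \row_i tnth [tuple x; y; z] i.

Section WeightedPlane.
Variables (K : fieldType) (a : nat).

Definition wscale (lam : K) (v : 'rV[K]_3) : 'rV[K]_3 :=
  \row_i (lam ^+ weight a i * v 0 i).

(* A point [p_0 : p_1 : p_2] of P(1,1,a) is the orbit itself, as a set of
   vectors, so equality of points is equality of orbits. *)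
Definition wpoint (v : 'rV[K]_3) : set 'rV[K]_3 :=
  [set wscale lam v | lam in [set lam : K | lam != 0]].

Definition wplane : set (set 'rV[K]_3) :=
  [set wpoint v | v in [set v : 'rV[K]_3 | v != 0]].

End WeightedPlane.

Section RationalPoints.
Variables (F : finFieldType) (K : fieldType) (iota : {rmorphism F -> K}).
Variable a : nat.

Definition rat_wpoint (v : 'rV[F]_3) : set 'rV[K]_3 :=
  wpoint a (map_mx iota v).

Definition YQ : set (set 'rV[K]_3) :=
  [set p | exists t0 t1 t2 : F, [/\ t0 != 0, t1 != 0, t2 != 0 &
     p = rat_wpoint (vec3 t0 t1 (t2 ^+ a))]].

Lemma YQ_sub_wplane : YQ `<=` wplane a.
Proof.
move=> p [t0 [t1 [t2 [t0_neq0 _ _ ->]]]].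
exists (map_mx iota (vec3 t0 t1 (t2 ^+ a))) => //=.
apply: contra_neq t0_neq0 => /rowP /(_ ord0).
by rewrite !mxE /tnth /= => /eqP; rewrite fmorph_eq0 => /eqP.
Qed.

(* P lists the points of Y without repetition, each by a fixed vector with
   coordinates in F. *)
Definition represents (Y : set (set 'rV[K]_3)) (N : nat)
    (P : 'I_N -> 'rV[F]_3) : Prop :=
  set_bij [set: 'I_N] Y (fun j => rat_wpoint (P j)).

End RationalPoints.

Section WeightedDegree.
Variable a : nat.

Definition wdeg (m : 'X_{1..3}) : nat := (\sum_(i < 3) m i * weight a i)%N.

Fact wdeg0 : wdeg 0%MM = 0%N.
Proof. by rewrite /wdeg big1 // => i _; rewrite mnm0E. Qed.

Fact wdegD : {morph wdeg : m1 m2 / (m1 + m2)%MM >-> (m1 + m2)%N}.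
Proof.
move=> m1 m2; rewrite /wdeg -big_split; apply: eq_bigr => i _ /=.
by rewrite mnmDE mulnDl.
Qed.

HB.instance Definition _ := isMeasure.Build 3 wdeg wdeg0 wdegD.

End WeightedDegree.

Section EvaluationCode.
Variables (F : finFieldType) (a alpha N : nat) (P : 'I_N -> 'rV[F]_3).

Definition eval_at (p : {mpoly F[3]}) : 'rV[F]_N := \row_j p.@[P j 0].

Definition codewords : set 'rV[F]_N :=
  [set eval_at p |
     p in [set p : {mpoly F[3]} | p \is alpha.-homog for (wdeg a)]].

(* The span only packages the set of codewords, already a linear subspace, as
   a {vspace _}: see mem_code. *)
Definition code : {vspace 'rV[F]_N} :=
  <<enum [set c : 'rV[F]_N | `[< codewords c >]]%SET>>%VS.

Lemma mem_code (c : 'rV[F]_N) : c \in code <-> codewords c.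
Proof.
split=> [|cC]; last by apply: memv_span; rewrite mem_enum inE; apply/asboolP.
move=> /coord_span ->; elim/big_rec: _ => [|i x _ [p hp <-]].
  exists 0; first exact: rpred0.
  by apply/rowP => j; rewrite !mxE meval0.
have : (enum [set c : 'rV[F]_N | `[< codewords c >]]%SET)`_i
    \in [set c : 'rV[F]_N | `[< codewords c >]]%SET.
  by rewrite -mem_enum mem_nth // -cardE.
rewrite inE => /asboolP [r hr <-].
move: (coord _ _ _) => u; exists (u *: r + p).
  by apply: rpredD => //; apply: rpredZ.
by apply/rowP => j; rewrite !mxE mevalD mevalZ.
Qed.

End EvaluationCode.

Section MinimumDistance.
Variables (F : finFieldType) (N : nat).

Definition hweight (c : 'rV[F]_N) : nat := #|[set j | c 0 j != 0]%SET|.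

(* Hamming weights are at most N, so the default value N is only visible for
   the zero code. *)
Definition min_dist (C : {vspace 'rV[F]_N}) : nat :=
  \big[minn/N]_(c : 'rV[F]_N | (c \in C) && (c != 0)) hweight c.

End MinimumDistance.

(* Main.v *)
(* Normalising the first coordinate to 1 identifies Y_Q with F^* x A, where A is
   the group of nonzero a-th powers, of order d2; homogeneity makes the code
   diagonally equivalent to the evaluation on F^* x A of the polynomials in
   (t, s) spanned by the t^i s^j with i + a j <= alpha.  Exponents may be reduced
   modulo q - 1 and d2, and the reduced monomials are linearly independent as
   functions, so the dimension is a lattice point count.  If f has t-degree u
   and vanishes identically in t at v elements of A, then some t^u s^j with
   j >= v occurs in f, so u + a v <= alpha, while f has at least
   (q - 1 - u)(d2 - v) nonzero values.  Products of linear factors attain each of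
   these values, so the minimum distance is the minimum of (q - 1 - u)(d2 - v). *)
Require Import Defs.
From mathcomp Require Import all_boot all_order all_algebra.
From mathcomp Require Import all_classical.
From mathcomp Require Import mpoly.
From mathcomp Require Import finfield.
From mathcomp Require Import ring zify.

Set Implicit Arguments.
Unset Strict Implicit.
Unset Printing Implicit Defensive.

Import GRing.Theory Num.Theory.

Local Open Scope ring_scope.

(** * Nonzero [a]-th powers in a finite field *)

Section FiniteFieldPowers.
Variable F : finFieldType.

Lemma card_neq0 : #|[set t : F | t != 0]%SET| = #|F|.-1.
Proof.
rewrite -(cardC1 (0 : F)); by apply: eq_card => t; rewrite !inE.
Qed.

Lemma card_field_pred_gt0 : (0 < #|F|.-1)%N.
Proof. by have := finNzRing_gt1 F; case: #|F| => [|[]]. Qed.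

Lemma expf_card_pred (x : F) : x != 0 -> x ^+ #|F|.-1 = 1.
Proof.
move=> x0; apply: (mulfI x0); rewrite -exprS mulr1 prednK ?expf_card //.
by apply: leq_trans card_field_pred_gt0 (leq_pred _).
Qed.

Lemma card_unity_roots_le n :
  (0 < n)%N -> (#|[set x : F | (x ^+ n == 1)%R]%SET| <= n)%N.
Proof.
move=> n0; rewrite cardE; apply: max_unity_roots => //; last exact: enum_uniq.
by apply/allP => x; rewrite mem_enum inE unity_rootE.
Qed.

Definition nzpowers a : {set F} := [set (t ^+ a)%R | t in [set t : F | t != 0]]%SET.

Lemma nzpowers_neq0 a s : s \in nzpowers a -> s != 0.
Proof. by case/imsetP => t; rewrite inE => t0 ->; apply: expf_neq0. Qed.

Lemma expr_nzpowers a s : s \in nzpowers a ->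
  s ^+ (#|F|.-1 %/ gcdn a #|F|.-1) = 1.
Proof.
case/imsetP => t; rewrite inE => t0 ->.
rewrite -exprM muln_divA ?dvdn_gcdr // -divn_mulAC ?dvdn_gcdl // mulnC exprM.
by rewrite expf_card_pred // expr1n.
Qed.

(** Bézout in the natural numbers: some multiple of [m] is a multiple of [n] plus the gcd. *)
Lemma expr_gcdn_eq1 (x : F) m n : (0 < m)%N ->
  x ^+ m = 1 -> x ^+ n = 1 -> x ^+ gcdn m n = 1.
Proof.
move=> m0 xm xn; case: (egcdnP n m0) => km kn eqk _.
have := congr1 (fun e => x ^+ e) eqk.
by rewrite mulnC exprM xm expr1n exprD mulnC exprM xn expr1n mul1r => <-.
Qed.

(** The count needs no generator of the unit group. Every [a]-th power is a root of [X^d - 1], so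
    there are at most [d]. The quotient of two elements in one fibre of [t -> t^a] is a [g]-th root
    of unity, so fibres have at most [g] elements and there are at least [(q-1)/g = d] of them. *)
Lemma card_nzpowers a : (0 < a)%N ->
  #|nzpowers a| = (#|F|.-1 %/ gcdn a #|F|.-1)%N.
Proof.
move=> a0; set g := gcdn a _; set d := (_ %/ g)%N.
have n0 := card_field_pred_gt0.
have g0 : (0 < g)%N by rewrite gcdn_gt0 a0.
have d0 : (0 < d)%N by rewrite divn_gt0 // dvdn_leq // dvdn_gcdr.
apply/eqP; rewrite eqn_leq; apply/andP; split.
  apply: leq_trans (card_unity_roots_le d0); apply: subset_leq_card.
  by apply/fintype.subsetP => s /expr_nzpowers sd; rewrite inE; apply/eqP.
rewrite -(leq_pmul2r g0) divnK ?dvdn_gcdr // -card_neq0 -sum1_card.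
rewrite (partition_big (fun t : F => t ^+ a) (mem (nzpowers a))) /=; last first.
  by move=> t tn0; apply: imset_f.
rewrite -sum_nat_const; apply: leq_sum => _ /imsetP[t0 + ->].
rewrite inE => t0n0; rewrite sum1_card.
have ti0 : t0^-1 != 0 by rewrite invr_eq0.
apply: leq_trans (card_unity_roots_le g0).
rewrite -(card_imset _ (mulIf ti0)); apply: subset_leq_card.
apply/fintype.subsetP => _ /imsetP[t + ->]; rewrite !inE => /andP[tn0 /eqP ta].
apply/eqP/expr_gcdn_eq1 => //.
  by rewrite expr_div_n ta divff // expf_neq0.
by apply: expf_card_pred; apply: mulf_neq0 => //; rewrite inE in tn0.
Qed.

End FiniteFieldPowers.

(** * Weights of bivariate polynomials on a product grid *)

Lemma card_setXI (T1 T2 : finType) (U : {set T1}) (V : {set T2})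
    (p : T1 -> T2 -> bool) :
  #|[set x in finset.setX U V | p x.1 x.2]%SET|
  = (\sum_(y in V) #|[set x in U | p x y]%SET|)%N.
Proof.
rewrite -sum1_card.
under [RHS]eq_bigr do rewrite -sum1_card.
rewrite (exchange_big_dep (mem U)) /=; last by move=> y x _; rewrite inE => /andP[].
rewrite pair_big_dep /=; apply: eq_bigl => -[x y] /=; rewrite !inE /=.
by case: (x \in U); case: (y \in V).
Qed.

(** Reduced polynomials are kept as finite coefficient tables, so that over a finite field they can
    be counted. *)
Definition grid_eval (F : fieldType) (n d : nat) (g : {ffun 'I_n * 'I_d -> F})
    (t s : F) : F :=
  \sum_e g e * t ^+ e.1 * s ^+ e.2.

Lemma horner_rVpoly_sum (R : comNzRingType) d (v : 'rV[R]_d) x :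
  (rVpoly v).[x] = \sum_(j < d) v 0 j * x ^+ j.
Proof. by rewrite horner_poly; apply: eq_bigr => j _; rewrite valK. Qed.

Lemma rVpoly_eq0 (R : nzRingType) d (v : 'rV[R]_d) : (rVpoly v == 0) = (v == 0).
Proof.
apply/eqP/eqP => [v0 | ->]; last exact: linear0.
by apply/rowP => j; rewrite -coef_rVpoly_ord v0 coef0 mxE.
Qed.

Lemma card_roots_lt (F : finFieldType) (p : {poly F}) (U : {set F}) :
  p != 0 -> (forall x, x \in U -> root p x) -> (#|U| < size p)%N.
Proof.
move=> p0 rU; rewrite cardE; apply: max_poly_roots (enum_uniq _) => //.
by apply/allP => x; rewrite mem_enum => /rU.
Qed.

Lemma grid_weight (F : finFieldType) (U V : {set F}) (a alpha : nat)
    (g : {ffun 'I_#|U| * 'I_#|V| -> F}) :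
  g != 0 -> (forall e, g e != 0 -> (e.1 + a * e.2 <= alpha)%N) ->
  exists u v, [/\ (u < #|U|)%N, (v < #|V|)%N, (u + a * v <= alpha)%N &
    ((#|U| - u) * (#|V| - v) <=
      #|[set x in finset.setX U V | (grid_eval g x.1 x.2 != 0)%R]%SET|)%N].
Proof.
move=> g_neq0 supp_g.
pose r (i : 'I_#|U|) : 'rV[F]_#|V| := \row_j g (i, j).
pose p i := rVpoly (r i).
have [[i1 j1] /= g1] : exists e, g e != 0.
  apply/existsP; rewrite -negb_forall; apply: contra g_neq0 => /forallP g0.
  by apply/eqP/ffunP => e; rewrite ffunE; apply/eqP.
have p1 : p i1 != 0.
  rewrite rVpoly_eq0; apply: contra_neq g1 => /rowP /(_ j1).
  by rewrite !mxE.
(* With [p i] the coefficient of [t^i], a polynomial in [s], the index [i0] is the degree in [t]. *)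
case: (@arg_maxnP _ i1 (fun i : 'I_#|U| => p i != 0) (@nat_of_ord _) p1).
move=> i0 p0 i0max.
pose Z := [set s in V | [forall i : 'I_#|U|, (p i).[s] == 0]]%SET.
have ZV : Z \subset V by apply/fintype.subsetP => s; rewrite inE => /andP[].
have ZltS : (#|Z| < size (p i0))%N.
  apply: card_roots_lt => // s; rewrite inE => /andP[_ /forallP /(_ i0)].
  by rewrite rootE.
have szp : (size (p i0) <= #|V|)%N by apply: size_poly.
have sz0 : (0 < size (p i0))%N by apply: leq_trans ZltS.
exists (nat_of_ord i0), #|Z|; split => //.
- exact: leq_trans szp.
(* The leading term of [p i0] is a monomial in the support of [g]; its degree is at least [#|Z|]
   because [p i0] vanishes on [Z]. *)
- have ltj : ((size (p i0)).-1 < #|V|)%N by rewrite prednK.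
  apply: (@leq_trans (i0 + a * (size (p i0)).-1)).
    by rewrite leq_add2l leq_mul2l -ltnS prednK // ZltS orbT.
  apply: (supp_g (i0, Ordinal ltj)).
  move: p0; rewrite -lead_coef_eq0 /lead_coef.
  by rewrite (coef_rVpoly_ord (r i0) (Ordinal ltj)) mxE.
(* Count by values of [s] and drop those in [Z]. For any other [s], the polynomial [Q] in [t] is
   nonzero of degree at most [i0], so it has at most [i0] zeros in [U]. *)
rewrite (card_setXI _ _ (fun t s => grid_eval g t s != 0)).
rewrite (bigID (mem Z)) /=; apply: leq_trans (leq_addl _ _).
have <- : #|V :\: Z|%SET = (#|V| - #|Z|)%N by rewrite cardsD (finset.setIidPr ZV).
rewrite mulnC -sum_nat_const.
rewrite [leqRHS](eq_bigl (mem (V :\: Z)%SET)); last first.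
  by move=> s; rewrite !inE; case: (s \in V); rewrite ?andbF ?andbT.
apply: leq_sum => s; rewrite !inE => /andP[+ sV].
rewrite sV /= negb_forall => /existsP[i2 ps].
pose Q : {poly F} := rVpoly (\row_i (p i).[s]).
have QE t : Q.[t] = grid_eval g t s.
  transitivity (\sum_i \sum_j g (i, j) * t ^+ i * s ^+ j); last first.
    by rewrite pair_bigA; apply: eq_bigr => -[].
  rewrite horner_rVpoly_sum; apply: eq_bigr => i _.
  rewrite mxE horner_rVpoly_sum mulr_suml.
  by apply: eq_bigr => j _; rewrite mxE mulrAC.
have Q0 : Q != 0.
  by rewrite rVpoly_eq0; apply: contra_neq ps => /rowP /(_ i2); rewrite !mxE.
have szQ : (size Q <= i0.+1)%N.
  apply/leq_sizeP => i lti; rewrite coef_rVpoly; case: insubP => // i' _ ii'.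
  rewrite mxE; have [-> | pi] := eqVneq (p i') 0; first by rewrite horner0.
  have : (i' <= i0)%N := i0max i' pi.
  by rewrite leqNgt ii' lti.
rewrite leq_subLR -[leqLHS](cardsID [set t | grid_eval g t s == 0]%SET U).
apply: leq_add; last first.
  by rewrite subset_leq_card //; apply/fintype.subsetP => t; rewrite !inE andbC.
rewrite -ltnS; apply: leq_trans szQ; apply: card_roots_lt => // t.
by rewrite !inE rootE QE => /andP[].
Qed.

(** A nonzero [g] has positive weight by [grid_weight], applied with [a = 0] and [alpha = #|U|] to
    make the degree condition vacuous. *)
Lemma grid_eval_eq0 (F : finFieldType) (U V : {set F})
    (g : {ffun 'I_#|U| * 'I_#|V| -> F}) :
  (forall t s, t \in U -> s \in V -> grid_eval g t s = 0) -> g = 0.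
Proof.
move=> g0; apply/eqP; apply: contraT => /(@grid_weight _ _ _ 0 #|U|).
case=> [e _ | u [v [ltu ltv _]]]; first by rewrite addn0 ltnW.
rewrite leqNgt [X in (X < _)%N]eq_card0 ?muln_gt0 ?subn_gt0 ?ltu ?ltv //.
by move=> [t s]; rewrite !inE /=; apply/negP => /andP[/andP[tU sV]]; rewrite g0 ?eqxx.
Qed.

Lemma grid_evalB (F : fieldType) n d (g h : {ffun 'I_n * 'I_d -> F}) t s :
  grid_eval (g - h) t s = grid_eval g t s - grid_eval h t s.
Proof.
rewrite /grid_eval -sumrB; apply: eq_bigr => e _.
by rewrite !ffunE !mulrBl.
Qed.

(** * Weighted monomials in three variables *)

Lemma big_ord3 (R : Type) (idx : R) (op : Monoid.law idx) (f : 'I_3 -> R) :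
  \big[op/idx]_(i < 3) f i = op (f 0) (op (f 1) (f 2%R)).
Proof.
rewrite !big_ord_recl big_ord0 Monoid.mulm1.
by congr (op (f _) (op (f _) (f _))); apply/val_inj.
Qed.

Lemma wdegE a m : wdeg a m = (m 0%R + m 1%R + a * m 2%R)%N.
Proof. by rewrite /wdeg big_ord3 /weight /tnth /= !muln1 addnA [(a * _)%N]mulnC. Qed.

Definition mon3 (x y z : nat) : 'X_{1..3} := [multinom tnth [tuple x; y; z] i | i < 3].

Lemma mon3E x y z :
  (mon3 x y z 0%R = x) * (mon3 x y z 1%R = y) * (mon3 x y z 2%R = z).
Proof. by split; [split|]; rewrite /mon3 mnmE. Qed.

Lemma mevalX_mon (F : comNzRingType) (v : 'rV[F]_3) (m : 'X_{1..3}) :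
  ('X_[m] : {mpoly F[3]}).@[v 0] = v 0 0 ^+ m 0%R * v 0 1 ^+ m 1%R * v 0 2%R ^+ m 2%R.
Proof. by rewrite mevalX big_ord3 /= mulrA. Qed.

(** * The evaluation code in the chart [x0 = 1] *)

Section TorusCode.
Variables (F : finFieldType) (a alpha N : nat) (P : 'I_N -> 'rV[F]_3).
Hypothesis a_gt0 : (0 < a)%N.

Let U : {set F} := [set t | t != 0]%SET.
Let V : {set F} := nzpowers F a.

(** The last two coordinates after scaling the first to 1. The bijectivity assumed below is supplied
    by [represents_chart]. *)
Definition chart (n : 'I_N) : F * F :=
  (P n 0 1 / P n 0 0, P n 0 2%R / P n 0 0 ^+ a).

Hypothesis P0_neq0 : forall n, P n 0 0 != 0.
Hypothesis chart_inj : injective chart.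
Hypothesis chart_im : chart @: [set: 'I_N]%SET = finset.setX U V.

Lemma chart_in n : ((chart n).1 \in U) * ((chart n).2 \in V).
Proof.
have : chart n \in finset.setX U V by rewrite -chart_im imset_f.
by case: (chart n) => t s; rewrite finset.in_setX => /andP[-> ->].
Qed.

Lemma chart_onto t s : t \in U -> s \in V -> exists n, chart n = (t, s).
Proof.
move=> tU sV; have : (t, s) \in finset.setX U V by rewrite finset.in_setX tU.
by rewrite -chart_im => /imsetP[n _ ->]; exists n.
Qed.

Lemma length_chart : N = (#|F|.-1 * (#|F|.-1 %/ gcdn a #|F|.-1))%N.
Proof.
rewrite -card_nzpowers // -card_neq0 -cardsX -chart_im.
by rewrite card_imset // cardsT card_ord.
Qed.

Lemma mevalX_chart n (m : 'X_{1..3}) :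
  ('X_[m] : {mpoly F[3]}).@[P n 0]
  = P n 0 0 ^+ wdeg a m * ((chart n).1 ^+ m 1%R * (chart n).2 ^+ m 2%R).
Proof.
have := P0_neq0 n; rewrite mevalX_mon wdegE /chart /=.
move: (P n 0 0) (P n 0 1) (P n 0 2%R) => x y z x0.
rewrite !exprD exprM !expr_div_n.
have : x ^+ m 1%R != 0 by rewrite expf_neq0.
have : (x ^+ a) ^+ m 2%R != 0 by rewrite !expf_neq0.
move: (x ^+ m 0%R) (x ^+ m 1%R) ((x ^+ a) ^+ _) => X0 X1 X2 X2n0 X1n0.
by field; rewrite X2n0 X1n0.
Qed.

Definition grid_word (g : {ffun 'I_#|U| * 'I_#|V| -> F}) : 'rV[F]_N :=
  \row_n (P n 0 0 ^+ alpha * grid_eval g (chart n).1 (chart n).2).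

(** Exponents of [x1] and [x2] only: in degree [alpha] the exponent of [x0] is the slack in the
    inequality. *)
Definition triangle : {set 'I_#|U| * 'I_#|V|} :=
  [set e : 'I_#|U| * 'I_#|V| | (e.1 + a * e.2 <= alpha)%N]%SET.

Lemma hweight_grid (h : F * F -> F) (c : 'rV[F]_N) :
  (forall n, (c 0 n != 0) = (h (chart n) != 0)) ->
  hweight c = #|[set x in finset.setX U V | h x != 0]%SET|.
Proof.
move=> ch; rewrite /hweight -(card_imset _ chart_inj); apply: eq_card => x.
rewrite [in RHS]inE -chart_im; apply/imsetP/andP => [[n + ->]|].
  by rewrite inE ch => ->; rewrite imset_f.
by case=> /imsetP[n _ ->] hn; exists n; rewrite // inE ch.
Qed.

Lemma hweight_grid_word g : hweight (grid_word g) =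
  #|[set x in finset.setX U V | grid_eval g x.1 x.2 != 0]%SET|.
Proof.
apply: (@hweight_grid (fun x => grid_eval g x.1 x.2)) => n.
by rewrite mxE mulf_eq0 expf_eq0 (negPf (P0_neq0 n)) andbF.
Qed.

Lemma grid_word_inj : injective grid_word.
Proof.
move=> g h /rowP gh; apply/eqP; rewrite -subr_eq0; apply/eqP.
apply: (@grid_eval_eq0 _ U V) => t s tU sV.
have [n cn] := chart_onto tU sV.
have := gh n; rewrite !mxE cn => /mulfI gh'.
by rewrite grid_evalB gh' ?subrr // expf_neq0.
Qed.

Lemma grid_word0 : grid_word 0 = 0.
Proof.
apply/rowP => n; rewrite !mxE /grid_eval big1 ?mulr0 // => e _.
by rewrite ffunE !mul0r.
Qed.

(* On the torus [t^(q-1) = 1] and [s^d2 = 1], so the exponents of a monomial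
   may be reduced modulo [q-1] and [d2]; this lowers the weighted degree. *)
Lemma grid_word_homog p : p \is alpha.-homog for (wdeg a) ->
  exists2 g, g \in pffun_on 0 (mem triangle) (mem [set: F]%SET) & eval_at P p = grid_word g.
Proof.
move=> hp.
have U0 : (0 < #|U|)%N by rewrite card_neq0 card_field_pred_gt0.
have V0 : (0 < #|V|)%N by apply/card_gt0P; exists (1 ^+ a); apply: imset_f; rewrite inE oner_neq0.
pose i (m : 'X_{1..3}) : 'I_#|U| := Ordinal (ltn_pmod (m 1%R) U0).
pose j (m : 'X_{1..3}) : 'I_#|V| := Ordinal (ltn_pmod (m 2%R) V0).
pose g : {ffun 'I_#|U| * 'I_#|V| -> F} :=
  [ffun e => \sum_(m <- msupp p | (i m, j m) == e) p@_m].
exists g.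
  apply/pffun_onP; split=> [|e _]; last by rewrite inE.
  apply/fintype.subsetP => e; rewrite !inE; apply: contraR => nE.
  rewrite ffunE big1_seq // => m /andP[/eqP me pm].
  have /= := dhomog_mf hp pm; rewrite wdegE => wm.
  case/negP: nE; rewrite -me -wm /=.
  rewrite leq_add ?leq_mul2l ?leq_mod ?orbT //.
  exact: leq_trans (leq_mod _ _) (leq_addl _ _).
apply/rowP => n; rewrite !mxE {1}(mpolyE p) raddf_sum /=.
have [tU sV] := chart_in n.
have redU m : (chart n).1 ^+ (m %% #|U|) = (chart n).1 ^+ m.
  apply: expr_mod; rewrite card_neq0 expf_card_pred //; by rewrite inE in tU.
have redV m : (chart n).2 ^+ (m %% #|V|) = (chart n).2 ^+ m.
  by apply: expr_mod; rewrite card_nzpowers // (expr_nzpowers sV).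
transitivity (P n 0 0 ^+ alpha * \sum_(m <- msupp p)
    p@_m * (chart n).1 ^+ i m * (chart n).2 ^+ j m).
  rewrite mulr_sumr; apply: eq_big_seq => m pm.
  by rewrite mevalZ mevalX_chart (dhomog_mf hp pm) mulrCA redU redV !mulrA.
congr (_ * _); rewrite (partition_big (fun m => (i m, j m)) predT) //=.
apply: eq_bigr => e _; rewrite ffunE !mulr_suml.
by apply: eq_bigr => m /eqP <-.
Qed.

(** Converse of [grid_word_homog]: each term is homogenised by the power of [x0] that fills the
    slack. *)
Lemma codewords_grid_word g : g \in pffun_on 0 (mem triangle) (mem [set: F]%SET) ->
  codewords a alpha P (grid_word g).
Proof.
case/pffun_onP => /fintype.subsetP supp_g _.
pose p : {mpoly F[3]} := \sum_(e in triangle)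
  g e *: 'X_[mon3 (alpha - (e.1 + a * e.2)) e.1 e.2].
exists p.
  apply: rpred_sum => e; rewrite inE => eE; apply: dhomogZ.
  by rewrite dhomogX /= wdegE !mon3E -addnA subnK.
apply/rowP => n; rewrite !mxE raddf_sum /= /grid_eval mulr_sumr.
rewrite [RHS](bigID (mem triangle)) /= [X in _ + X]big1 ?addr0 => [|e eE]; last first.
  have [->|/supp_g] := eqVneq (g e) 0; first by rewrite !mul0r mulr0.
  by rewrite (negPf eE).
apply: eq_bigr => e; rewrite inE => eE.
by rewrite mevalZ mevalX_chart /= wdegE !mon3E -addnA subnK // mulrCA !mulrA.
Qed.

Lemma code_grid_word c : reflect
  (exists2 g, g \in pffun_on 0 (mem triangle) (mem [set: F]%SET) & c = grid_word g)
  (c \in code a alpha P).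
Proof.
apply: (iffP idP) => [/mem_code[p hp <-] | [g gE ->]].
  exact: grid_word_homog.
by apply/mem_code/codewords_grid_word.
Qed.

(** By cardinality instead of a basis: [grid_word] is injective, so the code has [q ^ #|triangle|]
    elements. *)
Lemma dim_code : \dim (code a alpha P) = #|triangle|.
Proof.
have q1 : (1 < #|F|)%N := finNzRing_gt1 F.
apply/eqP; rewrite -(eqn_exp2l _ _ q1) -card_vspace -[in X in _ == X]cardsT.
rewrite -(card_pffun_on 0 (mem triangle) (mem [set: F]%SET)).
rewrite -(card_imset _ grid_word_inj); apply/eqP.
apply: eq_card => c; apply/code_grid_word/imsetP => -[g gE ->]; by exists g.
Qed.

Lemma code_weight_lb c : c \in code a alpha P -> c != 0 ->
  exists u v, [/\ (u < #|U|)%N, (v < #|V|)%N, (u + a * v <= alpha)%N &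
    ((#|U| - u) * (#|V| - v) <= hweight c)%N].
Proof.
case/code_grid_word => g /pffun_onP[/fintype.subsetP supp_g _] -> g0.
rewrite hweight_grid_word; apply: grid_weight.
  by apply: contra_neq g0 => ->; rewrite grid_word0.
by move=> e /supp_g; rewrite inE.
Qed.

Lemma code_weight_ub u v :
  (u < #|U|)%N -> (v < #|V|)%N -> (u + a * v <= alpha)%N ->
  exists c, [/\ c \in code a alpha P, c != 0 &
    hweight c = ((#|U| - u) * (#|V| - v))%N].
Proof.
move=> ltu ltv leuv.
have [rs [uniq_r size_r rU]] := card_geqP (ltnW ltu).
have [ss [uniq_s size_s sV]] := card_geqP (ltnW ltv).
(* The product of the [u] factors [x1 - r x0] and the [v] factors [x2 - s x0^a], padded by a power
   of [x0]. In the chart it vanishes exactly where [t] is in [rs] or [s] is in [ss]. *)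
pose p : {mpoly F[3]} := 'X_[mon3 (alpha - (u + a * v)) 0 0]
  * (\prod_(r <- rs) ('X_[mon3 0 1 0] - r *: 'X_[mon3 1 0 0])
  * \prod_(s <- ss) ('X_[mon3 0 0 1] - s *: 'X_[mon3 a 0 0])).
have homog_prod_const (I : Type) (r : seq I) (f : I -> {mpoly F[3]}) d :
    (forall i, f i \is d.-homog for (wdeg a)) ->
    \prod_(i <- r) f i \is (d * size r).-homog for (wdeg a).
  move=> hf; elim: r => [|i r IHr]; first by rewrite big_nil muln0 dhomog1.
  by rewrite big_cons mulnS dhomogM.
have hp : p \is alpha.-homog for (wdeg a).
  have -> : alpha = (alpha - (u + a * v) + (1 * size rs + a * size ss))%N.
    by rewrite mul1n size_r size_s subnK.
  apply: dhomogM; first by rewrite dhomogX /= wdegE !mon3E muln0 !addn0.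
  apply: dhomogM; apply: homog_prod_const => x; apply: rpredB;
    rewrite ?dhomogZ // dhomogX /= wdegE !mon3E ?muln0 ?muln1 ?addn0 //.
exists (eval_at P p).
pose h (x : F * F) := \prod_(r <- rs) (x.1 - r) * \prod_(s <- ss) (x.2 - s).
have hE n : (eval_at P p 0 n != 0) = (h (chart n) != 0).
  have -> : eval_at P p 0 n = P n 0 0 ^+ alpha * h (chart n).
    rewrite mxE /p !mevalM mevalX_chart !rmorph_prod /=.
    under eq_bigr => r _.
      rewrite mevalB mevalZ !mevalX_chart !wdegE !mon3E ?muln0 ?addn0 ?add0n.
      rewrite !expr0 !expr1 !mulr1 [r * _]mulrC -mulrBr.
    over.
    under [\prod_(s <- ss) _]eq_bigr => s _.
      rewrite mevalB mevalZ !mevalX_chart !wdegE !mon3E ?muln0 ?muln1 ?addn0 ?add0n.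
      rewrite !expr0 !expr1 !mul1r !mulr1 [s * _]mulrC -mulrBr.
    over.
    rewrite !big_split /= !big_const_seq !count_predT size_r size_s !iter_mulr_1.
    rewrite wdegE !mon3E !muln0 !addn0 !expr0 !mulr1.
    rewrite -[in RHS](subnK leuv) !exprD exprM /h.
    by rewrite !mulrA; congr (_ * _); rewrite -!mulrA; congr (_ * (_ * _)); rewrite mulrC.
  by rewrite mulf_eq0 expf_eq0 (negPf (P0_neq0 n)) andbF.
have wE : hweight (eval_at P p) = ((#|U| - u) * (#|V| - v))%N.
  rewrite (hweight_grid hE).
  have cardD (W : {set F}) xs : uniq xs -> {subset xs <= W} ->
      #|(W :\: [set x in xs])%SET| = (#|W| - size xs)%N.
    move=> uniq_xs xsW; rewrite cardsD (finset.setIidPr _); last first.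
      by apply/fintype.subsetP => x; rewrite inE => /xsW.
    by rewrite cardsE (card_uniqP uniq_xs).
  rewrite -size_r -size_s -!cardD // -cardsX; apply: eq_card => -[t s].
  rewrite inE !finset.in_setX !finset.in_setD ![_ \in [set _ in _]%SET]inE /h /= mulf_eq0.
  have root_in xs (x : F) : has (fun y => x - y == 0) xs = (x \in xs).
    by rewrite -has_pred1; apply: eq_has => y; rewrite /= subr_eq0 eq_sym.
  rewrite !prodf_seq_eq0 /= !root_in negb_or andbACA.
  by congr (_ && _); rewrite andbC // !inE.
split=> //; first by apply/mem_code; exists p.
(* The word is nonzero because its weight is positive. *)
apply: contra_eq_neq wE => ->; rewrite /hweight eq_card0 => [|n].
  by rewrite eq_sym -lt0n muln_gt0 !subn_gt0 ltu ltv.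
by rewrite !inE mxE eqxx.
Qed.
End TorusCode.

(** * Minimum distance from an attained lower bound *)

Lemma bigminn_le (I : eqType) (r : seq I) (Q : pred I) (f : I -> nat) m i :
  i \in r -> Q i -> (\big[minn/m]_(j <- r | Q j) f j <= f i)%N.
Proof.
move=> + Qi; elim: r => // j r IHr; rewrite inE big_cons => /predU1P[<-|ir].
  by rewrite Qi geq_minl.
by case: ifP => _; rewrite ?IHr // geq_min IHr ?orbT.
Qed.

Lemma min_dist_eq (F : finFieldType) N (C : {vspace 'rV[F]_N}) (delta : nat) :
  (exists c, [/\ c \in C, c != 0 & hweight c = delta]) ->
  (forall c, c \in C -> c != 0 -> (delta <= hweight c)%N) ->
  min_dist C = delta.
Proof.
case=> c [cC c0 wc] lb; apply/eqP; rewrite eqn_leq; apply/andP; split.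
  by rewrite -wc bigminn_le ?mem_index_enum // cC.
apply: (big_ind (fun x => delta <= x)%N) => [|x y dx dy|x /andP[]]; last exact: lb.
  (* The default value [N] does no harm: [delta] is itself a Hamming weight, hence at most [N]. *)
  by rewrite -wc -[leqRHS]card_ord max_card.
by rewrite leq_min dx.
Qed.

(** * Counting the lattice points of the truncated triangle *)

Section Triangle.
Local Open Scope nat_scope.

Lemma sum_row (n alpha b : nat) : \sum_(i < n) (i + b <= alpha) = minn n (alpha.+1 - b).
Proof.
elim: n => [|n IHn]; first by rewrite big_ord0 min0n.
by rewrite big_ord_recr /= IHn; case: leqP; lia.
Qed.

Lemma card_triangle (n d a alpha : nat) :
  #|[set e : 'I_n * 'I_d | e.1 + a * e.2 <= alpha]%SET|
  = \sum_(j < d) minn n (alpha.+1 - a * j).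
Proof.
rewrite -sum1_card big_mkcond /=.
under [RHS]eq_bigr do rewrite -sum_row.
rewrite exchange_big pair_bigA /=; apply: eq_bigr => e _.
by rewrite inE; case: leqP.
Qed.

(** The bound on [B] keeps every subtraction untruncated, so this is an arithmetic progression; the
    rationals accommodate the halving. *)
Lemma sum_arith (m n a B : nat) : m <= n -> a * n.-1 <= B ->
  ((\sum_(m <= j < n) (B - a * j))%:R
   = (n - m)%:R * (B%:R - (n%:R + m%:R - 1) * a%:R / 2) :> rat)%R.
Proof.
move=> lemn; rewrite -(subnKC lemn) addKn; move: (n - m) => l {lemn n}.
elim: l => [|l IHl] leB; first by rewrite addn0 big_geq // mul0r.
rewrite addnS big_nat_recr ?leq_addr //= natrD IHl; last first.
  by apply: leq_trans leB; rewrite leq_mul2l; lia.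
rewrite addnS /= in leB.
rewrite natrB // !natrM; rewrite -addn1 -[l.+1]addn1 !natrD; by field.
Qed.

(** Rows below [K] are cut off at length [n], rows from [K] to [mu] form an arithmetic progression,
    and later rows are empty. The two dimension formulas are the cases [K = 0] and [K = k + 1]. *)
Lemma sum_triangle (n d a alpha K : nat) (mu := minn (alpha %/ a) (d - 1)) :
  0 < a -> 0 < d -> K <= mu.+1 ->
  (forall j, j < K -> n <= alpha.+1 - a * j) ->
  (forall j, K <= j -> alpha.+1 - a * j <= n) ->
  ((\sum_(j < d) minn n (alpha.+1 - a * j))%:R
   = n%:R * K%:R + (mu%:R + 1 - K%:R)
     * (alpha%:R + 1 - (mu%:R + K%:R) * a%:R / 2) :> rat)%R.
Proof.
move=> a0 d0 leK full part.
have mud : mu.+1 <= d by rewrite /mu; lia.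
have mua : a * mu <= alpha.
  by apply: leq_trans (leq_trunc_div alpha a); rewrite mulnC leq_mul2r geq_minl orbT.
rewrite -(big_mkord predT (fun j => minn n (alpha.+1 - a * j))).
rewrite (big_cat_nat _ (n := K)) //=; last exact: leq_trans mud.
rewrite [X in _ + X](big_cat_nat _ (n := mu.+1)) //=.
rewrite [X in _ + (_ + X)]big_nat_cond [X in _ + (_ + X)]big1 ?addn0; last first.
  move=> j /andP[/andP[muj jd] _].
  have -> : alpha.+1 - a * j = 0; last by rewrite minn0.
  apply/eqP; rewrite subn_eq0.
  (* Since [j < d], exceeding [mu] means exceeding [alpha %/ a]. *)
  have ltj : alpha %/ a < j by move: muj jd; rewrite /mu; lia.
  by rewrite mulnC -ltn_divLR.
rewrite (eq_big_nat _ _ (F2 := fun=> n)) => [|j /andP[_ /full /minn_idPl //]].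
rewrite [X in _ + X](eq_big_nat _ _ (F2 := fun j => alpha.+1 - a * j)); last first.
  by move=> j /andP[/part /minn_idPr].
rewrite sum_nat_const_nat natrD natrM sum_arith //=; last exact: leqW.
rewrite subn0 natrB // -(addn1 mu) -(addn1 alpha) !natrD; by field.
Qed.

End Triangle.

(** * Minimising [(n - u)(d - v)] over the triangle *)

Section Arithmetic.
Local Open Scope nat_scope.

Lemma leq_divn_sub (a b m : nat) : 0 < a -> b <= m ->
  b + a * ((m - b) %/ a) <= m < b + a * ((m - b) %/ a).+1.
Proof.
move=> a0 le; have := ltn_pmod (m - b) a0; have := divn_eq (m - b) a.
by rewrite mulnC mulnS; move: (_ %/ a) (_ %% a) => k r; lia.
Qed.

(** From [n - u >= n - alpha + a v], the product exceeds [d (n - alpha)] by at least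
    [v (a (d - v) - (n - alpha))]. This is nonnegative because [n <= a d] and [a v <= alpha]. *)
Lemma dist_bound_small (n d a alpha u v : nat) :
  n <= a * d -> alpha < n -> v < d -> u + a * v <= alpha ->
  d * (n - alpha) <= (n - u) * (d - v).
Proof.
move=> nad alphan vd uv.
apply: (@leq_trans ((n - alpha + a * v) * (d - v))); last by rewrite leq_mul2r; lia.
have -> : d * (n - alpha) = (n - alpha) * (d - v) + v * (n - alpha).
  by rewrite [v * _]mulnC -mulnDr subnK 1?mulnC // ltnW.
rewrite mulnDl leq_add2l [a * v]mulnC -mulnA leq_mul2l mulnBr; apply/orP; right.
lia.
Qed.

(** If [v <= k], use [n - u >= 1]. Otherwise the constraint gives [n - u >= v - k + 1], and
    [(v - k + 1)(d - v) >= (d - v) + (v - k)] since [d - v >= 1]. *)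
Lemma dist_bound_large (n d a alpha k u v : nat) :
  0 < a -> alpha < n.-1 + a * k.+1 -> u < n -> v < d -> u + a * v <= alpha ->
  d - k <= (n - u) * (d - v).
Proof.
move=> a0 alphak un vd uv; have [vk|kv] := leqP v k.
  by apply: (@leq_trans (1 * (d - v))); [lia | rewrite leq_mul2r; lia].
have lex : (v - k).+1 <= n - u.
  have : a * k.+1 + (v - k.+1) <= a * v.
    by rewrite -[in leqRHS](subnKC kv) mulnDr leq_add2l leq_pmull.
  lia.
apply: (@leq_trans ((v - k).+1 * (d - v))); last by rewrite leq_mul2r lex orbT.
rewrite mulSn; have : v - k <= (v - k) * (d - v) by rewrite leq_pmulr // subn_gt0.
lia.
Qed.

End Arithmetic.

(** * Orbits in [Y_Q] and their normalised representatives *)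

Section Points.
Variables (F : finFieldType) (K : fieldType) (iota : {rmorphism F -> K}) (a : nat).
Let T := finset.setX [set t : F | t != 0]%SET (nzpowers F a).

Lemma vec3E (L : Type) (x y z : L) :
  (vec3 x y z 0 0 = x) * (vec3 x y z 0 1 = y) * (vec3 x y z 0 2%R = z).
Proof. by split; [split|]; rewrite mxE. Qed.

Lemma wscaleE (lam : K) (v : 'rV[K]_3) :
  (wscale a lam v 0 0 = lam * v 0 0) * (wscale a lam v 0 1 = lam * v 0 1)
  * (wscale a lam v 0 2%R = lam ^+ a * v 0 2%R).
Proof. by split; [split|]; rewrite mxE. Qed.

Lemma row3P (L : Type) (v w : 'rV[L]_3) :
  v 0 0 = w 0 0 -> v 0 1 = w 0 1 -> v 0 2%R = w 0 2%R -> v = w.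
Proof.
move=> e0 e1 e2; apply/rowP; case=> [[|[|[|//]]] lti].
- by rewrite (_ : Ordinal lti = 0) //; apply: val_inj.
- by rewrite (_ : Ordinal lti = 1) //; apply: val_inj.
- by rewrite (_ : Ordinal lti = 2%R) //; apply: val_inj.
Qed.

Lemma wscaleM (lam mu : K) v : wscale a lam (wscale a mu v) = wscale a (lam * mu) v.
Proof. by apply: row3P; rewrite !wscaleE ?exprMn mulrA. Qed.

Lemma wpoint_scale (mu : K) v : mu != 0 -> wpoint a (wscale a mu v) = wpoint a v.
Proof.
move=> mu0; apply/seteqP; split=> w [lam /= lam0 <-].
  by exists (lam * mu); rewrite ?wscaleM //= mulf_neq0.
exists (lam / mu); first by rewrite /= mulf_neq0 // invr_eq0.
by rewrite wscaleM divfK.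
Qed.

Lemma rat_wpoint_chart (v : 'rV[F]_3) : v 0 0 != 0 ->
  rat_wpoint iota a v
  = rat_wpoint iota a (vec3 1 (v 0 1 / v 0 0) (v 0 2%R / v 0 0 ^+ a)).
Proof.
move=> v0; have iv0 : iota (v 0 0) != 0 by rewrite fmorph_eq0.
rewrite /rat_wpoint -[RHS](wpoint_scale _ iv0); congr wpoint.
apply: row3P; rewrite wscaleE !mxE /=.
- by rewrite rmorph1 mulr1.
- by rewrite -rmorphM mulrC divfK.
- by rewrite -rmorphXn -rmorphM mulrC divfK // expf_neq0.
Qed.

(** The scalar relating the two vectors lies in [K], but the first coordinates force it to be
    [iota (v 0 0)]. The other coordinates can then be compared in [F], as [iota] is injective. *)
Lemma rat_wpoint_chart_inj (v : 'rV[F]_3) t s :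
  rat_wpoint iota a v = rat_wpoint iota a (vec3 1 t s) ->
  v 0 0 != 0 /\ (v 0 1 / v 0 0, v 0 2%R / v 0 0 ^+ a) = (t, s).
Proof.
move=> /seteqP[/(_ (map_mx iota v)) sub _].
have [|lam /= lam0 lamv] := sub.
  by exists 1; rewrite /= ?oner_neq0 //; apply: row3P; rewrite wscaleE ?expr1n mul1r.
have coord i := congr1 (fun u : 'rV[K]_3 => u 0 i) lamv.
have := coord 0; have := coord 1; have := coord 2%R; rewrite !wscaleE !mxE /=.
rewrite rmorph1 mulr1 => v2 v1 lamE.
have v0 : v 0 0 != 0 by rewrite -(fmorph_eq0 iota) -lamE.
split=> //; congr (_, _); apply: (fmorph_inj iota).
  by rewrite fmorph_div -v1 -lamE mulrC mulKf.
by rewrite fmorph_div rmorphXn -v2 -lamE mulrC mulKf // expf_neq0.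
Qed.

Lemma YQE : YQ iota a = [set rat_wpoint iota a (vec3 1 x.1 x.2) | x in [set` T]]%classic.
Proof.
apply/seteqP; split=> [_ [t0 [t1 [t2 [t00 t10 t20 ->]]]] | _ [[t s] /= tsT <-]].
  (* Scaling by [t0^-1] divides the last coordinate by [t0 ^+ a], so it remains an [a]-th power. *)
  exists (t1 / t0, (t2 / t0) ^+ a).
    rewrite /= finset.in_setX inE /= mulf_neq0 ?invr_eq0 //=.
    by apply: imset_f; rewrite inE mulf_neq0 ?invr_eq0.
  have /= := @rat_wpoint_chart (vec3 t0 t1 (t2 ^+ a)).
  by rewrite !vec3E expr_div_n => ->.
move: tsT; rewrite finset.in_setX inE /= => /andP[t0 /imsetP[r]].
by rewrite inE => r0 ->; exists 1, t, r; rewrite oner_neq0.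
Qed.

Lemma card_YQ : (YQ iota a #= `I_#|T|)%card.
Proof.
pose f (i : 'I_#|T|) := rat_wpoint iota a (vec3 1 (enum_val i).1 (enum_val i).2).
have -> : YQ iota a = [set f i | i in [set: 'I_#|T|]]%classic.
  rewrite YQE; apply/seteqP; split=> _ [x xT <-]; last first.
    by exists (enum_val x) => //=; apply: enum_valP.
  by exists (enum_rank_in xT x); rewrite // /f enum_rankK_in.
have f_inj : {in [set: 'I_#|T|]%classic &, injective f}.
  move=> i j _ _ /rat_wpoint_chart_inj[_]; rewrite !vec3E expr1n !divr1.
  by case ei: (enum_val i) => [x y]; case ej: (enum_val j) => [x' y'] /= [xx yy];
    apply: enum_val_inj; rewrite ei ej xx yy.
apply: card_eq_trans (inj_card_eq f_inj) _.
by rewrite card_eq_sym card_II.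
Qed.

(** Chart coordinates depend only on the orbit, so any choice of representatives meets the
    assumptions on [chart]. *)
Lemma represents_chart N (P : 'I_N -> 'rV[F]_3) :
  represents iota a (YQ iota a) P ->
  [/\ forall n, P n 0 0 != 0, injective (chart a P) &
      chart a P @: [set: 'I_N]%SET = T].
Proof.
rewrite YQE => -[P_fun P_inj P_surj].
have chartP n : P n 0 0 != 0 /\ chart a P n \in T.
  have [[t s] tsT /esym/rat_wpoint_chart_inj[P0 Pn]] := P_fun n I.
  by split=> //; rewrite /chart Pn.
split=> [n|n n' nn'|]; first by case: (chartP n).
  have [P0 _] := chartP n; have [P0' _] := chartP n'.
  apply: P_inj; [exact: mem_set | exact: mem_set |].
  rewrite /= rat_wpoint_chart // [RHS]rat_wpoint_chart //.
  by case: nn' => -> ->.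
apply/finset.setP => -[t s]; apply/imsetP/idP => [[n _ ->] | tsT].
  by case: (chartP n).
have [|n _ /rat_wpoint_chart_inj[_ Pn]] := P_surj (rat_wpoint iota a (vec3 1 t s)).
  by exists (t, s).
by exists n.
Qed.

End Points.

Theorem theorem5p1 (F : finFieldType) (K : closedFieldType)
    (iota : {rmorphism F -> K}) (K_alg : integralRange iota)
    (a : nat) (a_gt0 : (0 < a)%N) (alpha : nat) :
  let q : nat := #|F| in
  let d2 : nat := ((q - 1) %/ gcdn a (q - 1))%N in
  let k : int := ((alpha%:Z - (q%:Z - 2)) %/ a%:Z)%Z in
  let mu2 : nat := minn (alpha %/ a) (d2 - 1) in
  (YQ iota a #= `I_((q - 1) * d2))%card /\
  forall (N : nat) (P : 'I_N -> 'rV[F]_3), represents iota a (YQ iota a) P ->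
  let C := code a alpha P in
  let dim_case1 := alpha%:Z <= q%:Z - 2 in
  let dim_case2 := 0 < alpha%:Z - (q%:Z - 2) < (d2%:Z - 1) * a%:Z in
  let dist_case1 := alpha%:Z <= q%:Z - 2 in
  let dist_case2 := q%:Z - 2 <= alpha%:Z < (q%:Z - 2) + (d2%:Z - 1) * a%:Z in
  [/\ N = ((q - 1) * d2)%N,
   [/\ dim_case1 ->
         (\dim C)%:R = (mu2%:R + 1) * (alpha%:R + 1 - mu2%:R * a%:R / 2) :> rat,
       dim_case2 ->
         (\dim C)%:R = (q%:R - 1) * (k%:~R + 1)
           + (mu2%:R - k%:~R)
             * (alpha%:R + 1 - (mu2%:R + k%:~R + 1) * a%:R / 2) :> rat
     & ~~ dim_case1 -> ~~ dim_case2 -> \dim C = N] &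
   [/\ dist_case1 -> (min_dist C)%:Z = d2%:Z * (q%:Z - 1 - alpha%:Z),
       dist_case2 -> (min_dist C)%:Z = d2%:Z - k
     & ~~ dist_case1 -> ~~ dist_case2 -> min_dist C = 1%N]].
Proof.
move=> q d2 k mu2.
set n := #|F|.-1.
have n0 : (0 < n)%N := card_field_pred_gt0 F.
have qE : q = n.+1 by rewrite /n prednK // ltnW // finNzRing_gt1.
have q1 : (q - 1 = n)%N by rewrite /n -subn1.
have dE : #|nzpowers F a| = d2 by rewrite card_nzpowers // -/n -q1.
have d0 : (0 < d2)%N.
  by rewrite /d2 q1 divn_gt0 ?gcdn_gt0 ?a_gt0 // (dvdn_leq n0) ?dvdn_gcdr.
(* Here [n = d2 * gcdn a n] and the gcd is at most [a]. *)
have nad : (n <= a * d2)%N.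
  rewrite -q1 -[leqLHS](divnK (dvdn_gcdr a (q - 1))) mulnC leq_mul2r.
  by rewrite (dvdn_leq a_gt0) ?dvdn_gcdl ?orbT.
have dnE : (n %/ gcdn a n)%N = d2 by rewrite /d2 q1.
have qZ : q%:Z - 2 = n.-1%:Z by rewrite qE -(prednK n0) -addn2 PoszD addrK.
(* The integer [k] is negative for [alpha < q - 2]; from [q - 2 = n.-1] on it is a natural
   quotient. *)
have kE : (n.-1 <= alpha)%N -> k = ((alpha - n.-1) %/ a)%N.
  by move=> le; rewrite /k qZ subzn // divz_nat.
clearbody k d2.
split.
  by have := card_YQ iota a; rewrite cardsX card_neq0 -/n dE -q1.
move=> N P /represents_chart[P0 chart_inj chart_im] C dim1 dim2 dist1 dist2.
have NE : N = (n * d2)%N by rewrite (length_chart a_gt0 chart_inj chart_im) -/n dnE.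
have dimC := dim_code alpha a_gt0 P0 chart_im.
rewrite /triangle card_triangle card_neq0 dE -/n -/C in dimC.
have weight_lb := code_weight_lb (alpha := alpha) a_gt0 P0 chart_inj chart_im.
have weight_ub := code_weight_ub (alpha := alpha) P0 chart_inj chart_im.
rewrite card_neq0 dE -/n in weight_lb weight_ub.
have kP (le : (n.-1 <= alpha)%N) := leq_divn_sub a_gt0 le.
have dZ : (d2%:Z - 1) * a%:Z = (a * (d2 - 1))%N%:Z by rewrite mulnC PoszM -subzn.
rewrite /dim1 /dim2 /dist1 /dist2 dZ qZ {dim1 dim2 dist1 dist2}.
pose kn := ((alpha - n.-1) %/ a)%N; rewrite -/kn in kE kP.
clear dE dnE; clearbody n q kn.
have k_lt : (n.-1 <= alpha)%N -> (alpha < n.-1 + a * (d2 - 1))%N -> (kn < d2 - 1)%N.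
  move=> /kP/andP[kle _] lt; rewrite -(ltn_pmul2l a_gt0) -(ltn_add2l n.-1).
  exact: leq_ltn_trans lt.
have n1 : (n - n.-1 = 1)%N by lia.
split; first by rewrite q1.
- split=> [le|/andP[lt1 lt2]|nle nlt].
  + rewrite dimC (sum_triangle (K := 0)) // => [|j _]; last by lia.
    by rewrite mulr0 add0r subr0 addr0.
  + have le : (n.-1 <= alpha)%N by lia.
    have /andP[kle klt] := kP le; have kd := k_lt le ltac:(lia).
    (* Row [j] has full length [n] exactly when [n.-1 + a j <= alpha], that is, when [j <= kn]. *)
    rewrite dimC (sum_triangle (K := kn.+1)) //; last 3 first.
    * by rewrite ltnS leq_min leq_divRL // mulnC (leq_trans (leq_addl _ _) kle) ltnW.
    * by move=> j ltj; have : (a * j <= a * kn)%N by [rewrite leq_mul2l -ltnS ltj orbT]; lia.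
    * by move=> j ltj; have : (a * kn.+1 <= a * j)%N by [rewrite leq_mul2l ltj orbT]; lia.
    rewrite -/mu2 kE // qE -(addn1 n) -(addn1 kn) !natrD /=; by field.
  (* Now [alpha >= n.-1 + a (d2 - 1)], so all [d2] rows are full. *)
  + rewrite dimC NE mulnC -[in RHS](card_ord d2) -sum_nat_const.
    apply: eq_bigr => j _; apply/minn_idPl.
    have : (a * j <= a * (d2 - 1))%N by rewrite leq_mul2l; have := ltn_ord j; lia.
    lia.
- split=> [le|/andP[lt1 lt2]|nle nlt].
  + have le' : (alpha < n)%N by lia.
    have -> : q%:Z - 1 - alpha%:Z = (n - alpha)%N%:Z by rewrite qE; lia.
    rewrite -PoszM; congr Posz; apply: min_dist_eq.
      (* The minimum is attained at [(u, v) = (alpha, 0)] here, and at [(n.-1, kn)] and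
         [(n.-1, d2 - 1)] in the next two cases. *)
      have [|c [cC c0 wc]] := weight_ub alpha 0 le' d0; first by rewrite muln0 addn0.
      by exists c; split; rewrite // wc subn0 mulnC.
    move=> c cC c0; have [u [v [ltu ltv uv]]] := weight_lb _ cC c0.
    by apply: leq_trans; apply: dist_bound_small uv.
  + have le : (n.-1 <= alpha)%N by lia.
    have /andP[kle klt] := kP le; have kd := k_lt le ltac:(lia).
    rewrite kE // subzn; last by lia.
    congr Posz; apply: min_dist_eq.
      have [|||c [cC c0 wc]] := weight_ub n.-1 kn; [lia | lia | exact: kle |].
      by exists c; split; rewrite // wc n1 mul1n.
    move=> c cC c0; have [u [v [ltu ltv uv]]] := weight_lb _ cC c0.
    by apply: leq_trans; apply: dist_bound_large uv.
  + apply: min_dist_eq.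
      have [|||c [cC c0 wc]] := weight_ub n.-1 (d2 - 1)%N; [lia | lia | lia |].
      by exists c; split; rewrite // wc n1 mul1n subKn.
    move=> c cC c0; have [u [v [ltu ltv _]]] := weight_lb _ cC c0.
    by apply: leq_trans; rewrite muln_gt0 !subn_gt0 ltu.
Qed.
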